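(* Let $0<u<1$ and let ${\mathcal Q} = u\,{\rm Re}\,{\mathcal Q_1} + (1-u)\,{\rm Re}\,{\mathcal Q_2} + {\rm Re}\,{\mathcal Q_3}$ be a negative definite matrix, where ${\mathcal Q_1},{\mathcal Q_2},{\mathcal Q_3}$ are the $6\times 6$ matrices defined in the context below, and let ${\bf b} = (0,1,0,0,0,1)^\top$. Then when ${\mathcal Q}$ is full rank for all $0<u<1$, the Holevo Cramér–Rao bound (with identity weight matrix) satisfies $\mathscr{L}_u \le C_{\mathsf{H}} \le \mathscr{U}_u$, where \[ \mathscr{L}_u = -\frac{1}{4} {\bf b}^\top {\mathcal Q}^{-1} {\bf b},\qquad \mathscr{U}_u = \frac{1}{4} \max\left\{ {\bf b}^{\top}{\mathcal Q}^{-1} {\mathcal Q_1} {\mathcal Q}^{-1} {\bf b},\ {\bf b}^{\top} {\mathcal Q}^{-1} {\mathcal Q_2} {\mathcal Q}^{-1} {\bf b} \right\}, \] with equality on both sides attained at the stationary point of the lower bound with respect to $u$, i.e. when $\frac{d}{du}({\bf b}^\top {\mathcal Q}^{-1} {\bf b}) = ({\bf b}^\top {\mathcal Q}^{-1} \frac{d{\mathcal Q}}{du} {\mathcal Q}^{-1} {\bf b}) = 0$.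
   Context: Two-parameter estimation with a full-rank density matrix $\rho=\rho(\theta_1,\theta_2)$ of dimension $D$ with spectral decomposition $\rho=\sum_j p_j|e_j\rangle\langle e_j|$, and $\rho_1=\partial_1\rho$, $\rho_2=\partial_2\rho$. The HCRB with identity weight is $C_{\mathsf H}=\min_{X_1,X_2}\{{\rm Tr}\,{\rm Re}Z+\|{\rm Im}Z\|_1\}$ over Hermitian $X_1,X_2$ with ${\rm Tr}(\rho X_j)=0$, ${\rm Tr}(\partial_j\rho X_k)=\delta_{jk}$, where $Z_{jk}={\rm Tr}(\rho X_jX_k)$. For $0<u<1$ define $\gamma_1=-\mathbb{1}_D/2$, $\gamma_2=-\sum_{j,k}(u p_k+(1-u)p_j)^{-1}\langle e_j|\rho_1/2|e_k\rangle|e_j\rangle\langle e_k|$, $\gamma_3=-\sum_{j,k}(u p_k+(1-u)p_j)^{-1}\langle e_j|\rho_2/2|e_k\rangle|e_j\rangle\langle e_k|$. Define the $3\times3$ matrices $G_1=\begin{pmatrix}1/4&0&0\\0&{\rm Tr}(\gamma_2\rho\gamma_2^\dagger)&{\rm Tr}(\gamma_2\rho\gamma_3^\dagger)\\0&{\rm Tr}(\gamma_3\rho\gamma_2^\dagger)&{\rm Tr}(\gamma_3\rho\gamma_3^\dagger)\end{pmatrix}$, $G_2=\begin{pmatrix}1/4&0&0\\0&{\rm Tr}(\gamma_2^\dagger\rho\gamma_2)&{\rm Tr}(\gamma_2^\dagger\rho\gamma_3)\\0&{\rm Tr}(\gamma_3^\dagger\rho\gamma_2)&{\rm Tr}(\gamma_3^\dagger\rho\gamma_3)\end{pmatrix}$,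 $G_3=\begin{pmatrix}-1/2&0&0\\0&{\rm Tr}(\rho_1\gamma_2)&{\rm Tr}(\rho_1\gamma_3)\\0&{\rm Tr}(\rho_2\gamma_2)&{\rm Tr}(\rho_2\gamma_3)\end{pmatrix}$, and the $6\times6$ block matrices ${\mathcal Q_1}=\begin{pmatrix}G_1&-iG_1\\ iG_1&G_1\end{pmatrix}$, ${\mathcal Q_2}=\begin{pmatrix}G_2&iG_2\\ -iG_2&G_2\end{pmatrix}$, ${\mathcal Q_3}=\frac12\begin{pmatrix}G_3+G_3^*&i(G_3-G_3^* )\\ -i(G_3-G_3^* )&G_3+G_3^*\end{pmatrix}$. *)

(* Defs.v *)
From HB Require Import structures.
From mathcomp Require Import all_boot all_order all_algebra.
From mathcomp Require Import all_classical all_reals all_analysis.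
From mathcomp.real_closed Require Import complex.

Set Implicit Arguments.
Unset Strict Implicit.
Unset Printing Implicit Defensive.

Import Order.TTheory GRing.Theory Num.Theory.
Local Open Scope ring_scope.
Local Open Scope classical_set_scope.

Section Defs.
Variable R : realType.
Local Notation C := (complex R).

Definition iC : C := Complex 0 1.
Definition toC (x : R) : C := Complex x 0.

Definition conjmx m n (A : 'M[C]_(m, n)) : 'M[C]_(m, n) := map_mx (@complex.conjc R) A.
Definition dagger m n (A : 'M[C]_(m, n)) : 'M[C]_(n, m) := (conjmx A)^T.
Definition Remx m n (A : 'M[C]_(m, n)) : 'M[R]_(m, n) := map_mx (@complex.Re R) A.
Definition Immx m n (A : 'M[C]_(m, n)) : 'M[R]_(m, n) := map_mx (@complex.Im R) A.

Definition hermmx n (A : 'M[C]_n) := dagger A = A.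
Definition unitmx_C n (U : 'M[C]_n) := U *m dagger U = 1%:M.

Definition negdef n (A : 'M[R]_n) :=
  forall x : 'cV[R]_n, x != 0 -> (x^T *m A *m x) 0 0 < 0.

(* trace norm (Schatten-1 norm, sum of singular values) of a real 2x2 matrix:
   s1 + s2 = sqrt(s1^2 + s2^2 + 2 s1 s2) = sqrt(||A||_F^2 + 2 |det A|). *)
Definition trnorm2 (A : 'M[R]_2) : R :=
  Num.sqrt (\sum_(i < 2) \sum_(j < 2) A i j ^+ 2 + 2 * `|\det A|).

Definition feasible D (rho rho1 rho2 : 'M[C]_D) (X : 'I_2 -> 'M[C]_D) :=
  (forall j, hermmx (X j)) /\
  (forall j, \tr (rho *m X j) = 0) /\
  (forall j k, \tr ((if j == 0 then rho1 else rho2) *m X k)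
               = (if j == k then 1 else 0)).

Definition Zmat D (rho : 'M[C]_D) (X : 'I_2 -> 'M[C]_D) : 'M[C]_2 :=
  \matrix_(j < 2, k < 2) \tr (rho *m X j *m X k).

Definition HCRB D (rho rho1 rho2 : 'M[C]_D) : R :=
  inf [set c | exists X, feasible rho rho1 rho2 X /\
         c = \tr (Remx (Zmat rho X)) + trnorm2 (Immx (Zmat rho X))].

(* ---- gamma operators, built from the spectral decomposition
   rho = U diag(p) U^dagger, e_j = j-th column of U ---- *)
Definition gam_op D (U : 'M[C]_D) (p : 'I_D -> R) (u : R) (A : 'M[C]_D)
  : 'M[C]_D :=
  - (U *m (\matrix_(j < D, k < D)
             ((toC (u * p k + (1 - u) * p j))^-1
              * (dagger U *m (2%:R^-1 *: A) *m U) j k)) *m dagger U).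

Definition gam D (U : 'M[C]_D) (p : 'I_D -> R) (rho1 rho2 : 'M[C]_D) (u : R)
  (i : 'I_3) : 'M[C]_D :=
  if i == 0 then - (2%:R^-1 *: 1%:M)
  else if i == 1 then gam_op U p u rho1 else gam_op U p u rho2.

Definition Gmat1 D (rho rho1 rho2 U : 'M[C]_D) p u : 'M[C]_3 :=
  \matrix_(i < 3, j < 3)
    if (i == 0) || (j == 0) then (if (i == 0) && (j == 0) then 4%:R^-1 else 0)
    else \tr (gam U p rho1 rho2 u i *m rho *m dagger (gam U p rho1 rho2 u j)).

Definition Gmat2 D (rho rho1 rho2 U : 'M[C]_D) p u : 'M[C]_3 :=
  \matrix_(i < 3, j < 3)
    if (i == 0) || (j == 0) then (if (i == 0) && (j == 0) then 4%:R^-1 else 0)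
    else \tr (dagger (gam U p rho1 rho2 u i) *m rho *m gam U p rho1 rho2 u j).

Definition Gmat3 D (rho rho1 rho2 U : 'M[C]_D) p u : 'M[C]_3 :=
  \matrix_(i < 3, j < 3)
    if (i == 0) || (j == 0) then (if (i == 0) && (j == 0) then - 2%:R^-1 else 0)
    else \tr ((if i == 1 then rho1 else rho2) *m gam U p rho1 rho2 u j).

Definition Qmat1 D (rho rho1 rho2 U : 'M[C]_D) p u : 'M[C]_(3 + 3) :=
  let G := Gmat1 rho rho1 rho2 U p u in
  block_mx G (- iC *: G) (iC *: G) G.

Definition Qmat2 D (rho rho1 rho2 U : 'M[C]_D) p u : 'M[C]_(3 + 3) :=
  let G := Gmat2 rho rho1 rho2 U p u in
  block_mx G (iC *: G) (- iC *: G) G.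

Definition Qmat3 D (rho rho1 rho2 U : 'M[C]_D) p u : 'M[C]_(3 + 3) :=
  let G := Gmat3 rho rho1 rho2 U p u in
  2%:R^-1 *: block_mx (G + conjmx G) (iC *: (G - conjmx G))
                      (- iC *: (G - conjmx G)) (G + conjmx G).

Definition Qmat D (rho rho1 rho2 U : 'M[C]_D) p u : 'M[R]_(3 + 3) :=
  u *: Remx (Qmat1 rho rho1 rho2 U p u)
  + (1 - u) *: Remx (Qmat2 rho rho1 rho2 U p u)
  + Remx (Qmat3 rho rho1 rho2 U p u).

Definition bvec : 'cV[R]_(3 + 3) :=
  \col_(i < 3 + 3) (if (val i == 1)%N || (val i == 5)%N then 1 else 0).

Definition bQb D (rho rho1 rho2 U : 'M[C]_D) p u : R :=
  (bvec^T *m invmx (Qmat rho rho1 rho2 U p u) *m bvec) 0 0.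

Definition lowerL D (rho rho1 rho2 U : 'M[C]_D) p u : R :=
  - 4%:R^-1 * bQb rho rho1 rho2 U p u.

(* b^T Q^{-1} Qk Q^{-1} b  (a real number since Qk is Hermitian) *)
Definition bQQQb D (rho rho1 rho2 U : 'M[C]_D) p u (Qk : 'M[C]_(3 + 3)) : R :=
  let x := map_mx toC (invmx (Qmat rho rho1 rho2 U p u) *m bvec) in
  complex.Re ((x^T *m Qk *m x) 0 0).

Definition upperU D (rho rho1 rho2 U : 'M[C]_D) p u : R :=
  4%:R^-1 * Num.max (bQQQb rho rho1 rho2 U p u (Qmat1 rho rho1 rho2 U p u))
                    (bQQQb rho rho1 rho2 U p u (Qmat2 rho rho1 rho2 U p u)).

End Defs.

(* Main.v *)
(* Encode a pair of Hermitian operators as L = X_1 + i X_2. The constraints become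
   the complex-linear conditions Tr(rho L) = 0, Tr(rho_1 L) = 1, Tr(rho_2 L) = i, and
   the Holevo function becomes max(Tr L rho L^+, Tr L^+ rho L). For each v this maximum
   dominates the convex combination v Tr L rho L^+ + (1-v) Tr L^+ rho L, a positive
   quadratic form whose Gram matrix on the gamma_i is, in real coordinates, -Q(v). Its
   constrained minimiser L_v is the combination of the gamma_i with coordinates
   Q^-1 b / 2; the minimum is the lower bound, and the Holevo function at the feasible
   point L_v is the upper bound.

   For the equality case, let m(v) be the minimum. The point L_u is feasible for every v,
   so m(v) <= m(u) + (v - u) (Tr L_u rho L_u^+ - Tr L_u^+ rho L_u): the slope is m'(u),
   hence vanishes at a stationary point, and the two members of the maximum coincide. *)
Require Import Defs.
From HB Require Import structures.
From mathcomp Require Import all_boot all_order all_algebra.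
From mathcomp Require Import all_classical all_reals all_analysis.
From mathcomp.real_closed Require Import complex.
From mathcomp Require Import ring lra.
Import Order.TTheory GRing.Theory Num.Theory.
Local Open Scope ring_scope.

Set Implicit Arguments.
Unset Strict Implicit.
Unset Printing Implicit Defensive.

(** * Adjoints, real parts and unitary conjugation *)

Section Dagger.
Variable R : realType.
Local Notation C := (complex R).

Lemma toCE (x : R) : toC x = real_complex R x. Proof. by []. Qed.

Lemma toCD (x y : R) : toC (x + y) = toC x + toC y.
Proof. exact: (rmorphD (real_complex R)). Qed.

Lemma toCM (x y : R) : toC (x * y) = toC x * toC y.
Proof. exact: (rmorphM (real_complex R)). Qed.

Lemma half_toC : 2%:R^-1 = toC 2%:R^-1 :> C.
Proof. by rewrite toCE rmorphV ?rmorph_nat // unitfE pnatr_eq0. Qed.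

Lemma conjcD (z w : C) : conjc (z + w) = conjc z + conjc w.
Proof. exact: rmorphD. Qed.

Lemma conjcM (z w : C) : conjc (z * w) = conjc z * conjc w.
Proof. exact: rmorphM. Qed.

Lemma conjc_toC (x : R) : conjc (toC x) = toC x.
Proof. exact: conjc_real. Qed.

Lemma daggerE m n (A : 'M[C]_(m, n)) i j : dagger A i j = conjc (A j i).
Proof. by rewrite !mxE. Qed.

Lemma daggerK m n (A : 'M[C]_(m, n)) : dagger (dagger A) = A.
Proof. by apply/matrixP => i j; rewrite !daggerE conjcK. Qed.

Lemma dagger_mul m n q (A : 'M[C]_(m, n)) (B : 'M[C]_(n, q)) :
  dagger (A *m B) = dagger B *m dagger A.
Proof.
apply/matrixP => i j; rewrite daggerE !mxE rmorph_sum; apply: eq_bigr => k _.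
by rewrite !daggerE rmorphM mulrC.
Qed.

Lemma daggerD m n (A B : 'M[C]_(m, n)) : dagger (A + B) = dagger A + dagger B.
Proof. by apply/matrixP => i j; rewrite !mxE rmorphD. Qed.

Lemma daggerN m n (A : 'M[C]_(m, n)) : dagger (- A) = - dagger A.
Proof. by apply/matrixP => i j; rewrite !mxE rmorphN. Qed.

Lemma daggerZ m n a (A : 'M[C]_(m, n)) :
  dagger (a *: A) = conjc a *: dagger A.
Proof. by apply/matrixP => i j; rewrite !mxE rmorphM. Qed.

Lemma dagger_sum m n I (r : seq I) (F : I -> 'M[C]_(m, n)) :
  dagger (\sum_(i <- r) F i) = \sum_(i <- r) dagger (F i).
Proof.
apply/matrixP => i j; rewrite daggerE !summxE rmorph_sum.
by apply: eq_bigr => k _; rewrite daggerE.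
Qed.

Lemma mxtrace_dagger n (A : 'M[C]_n) : \tr (dagger A) = conjc (\tr A).
Proof. by rewrite /mxtrace rmorph_sum; apply: eq_bigr => i _; rewrite daggerE. Qed.

Lemma Re_conjc (z : C) : complex.Re (conjc z) = complex.Re z.
Proof. by case: z. Qed.

Lemma ReD (z w : C) : complex.Re (z + w) = complex.Re z + complex.Re w.
Proof. by case: z; case: w. Qed.

Lemma Re_toCM x (z : C) : complex.Re (toC x * z) = x * complex.Re z.
Proof. by case: z => a b /=; rewrite mul0r subr0. Qed.

Lemma ReN (z : C) : complex.Re (- z) = - complex.Re z.
Proof. by case: z. Qed.

Lemma Re_sum I (r : seq I) (F : I -> C) :
  complex.Re (\sum_(i <- r) F i) = \sum_(i <- r) complex.Re (F i).
Proof. by apply: (big_morph _ ReD). Qed.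

Lemma unitmx_C_daggerl n (U : 'M[C]_n) : unitmx_C U -> dagger U *m U = 1%:M.
Proof. exact: mulmx1C. Qed.

Lemma mulmx_unitary_conj n (U M N : 'M[C]_n) : unitmx_C U ->
  (U *m M *m dagger U) *m (U *m N *m dagger U) = U *m (M *m N) *m dagger U.
Proof.
move=> /unitmx_C_daggerl UU.
by rewrite !mulmxA -[_ *m dagger U *m U]mulmxA UU mulmx1.
Qed.

Lemma mxtrace_dagger_ge0 m n (A : 'M[C]_(m, n)) : 0 <= \tr (A *m dagger A).
Proof.
apply: sumr_ge0 => i _; rewrite mxE; apply: sumr_ge0 => j _.
by rewrite daggerE mulcJ_ge0.
Qed.

End Dagger.

(** * Positivity of [rho] and the Lyapunov equation in its eigenbasis *)

Section Spectral.
Variables (R : realType) (D : nat).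
Local Notation C := (complex R).
Variables (rho U : 'M[C]_D) (p : 'I_D -> R).
Hypothesis U_unitary : unitmx_C U.
Hypothesis p_gt0 : forall j, 0 < p j.
Hypothesis rhoE : rho = U *m diag_mx (\row_j toC (p j)) *m dagger U.

Lemma rho_herm : dagger rho = rho.
Proof.
rewrite rhoE !dagger_mul daggerK mulmxA; congr (_ *m _ *m _).
apply/matrixP => i j; rewrite daggerE !mxE; case: eqVneq => [->|ij].
  by rewrite !mulr1n; exact: conjc_real.
by rewrite !mulr0n; exact: conjc0.
Qed.

Lemma rho_sqrt : exists S : 'M[C]_D, rho = S *m dagger S.
Proof.
exists (U *m diag_mx (\row_j toC (Num.sqrt (p j)))).
rewrite dagger_mul !mulmxA rhoE -!mulmxA; congr (_ *m _); rewrite mulmxA; congr (_ *m _).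
apply/matrixP => i j; rewrite mul_diag_mx !mxE; case: eqVneq => [->|ij].
  rewrite !mulr1n [conjc _]conjc_real !toCE -rmorphM /=.
  by rewrite -expr2 sqr_sqrtr// ltW.
by rewrite !mulr0n conjc0 mulr0.
Qed.

Lemma mxtrace_rho_ge0 (A : 'M[C]_D) : 0 <= \tr (A *m rho *m dagger A).
Proof.
have [S ->] := rho_sqrt.
by rewrite -(mulmxA A) -(mulmxA S) -dagger_mul mulmxA mxtrace_dagger_ge0.
Qed.

(** In the eigenbasis the left side multiplies entry (j,k) by v p_k + (1-v) p_j, which is exactly
    the positive weight that [gam_op] divides by. *)
Lemma gam_op_lyapunov (v : R) (A : 'M[C]_D) : 0 < v < 1 ->
  toC v *: (gam_op U p v A *m rho) + toC (1 - v) *: (rho *m gam_op U p v A)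
  = - (2%:R^-1 *: A).
Proof.
move=> /andP[v0 v1]; rewrite /gam_op.
set B := (2%:R^-1 *: A : 'M[C]_D); set M := (\matrix_(j, k) _ : 'M[C]_D).
rewrite rhoE mulNmx mulmxN !mulmx_unitary_conj //.
rewrite !scalerN -opprD !(scalemxAl _ (U *m _)) -mulmxDl !(scalemxAr _ U) -mulmxDr; congr (- _).
have -> : toC v *: (M *m diag_mx (\row_j toC (p j))) +
    toC (1 - v) *: (diag_mx (\row_j toC (p j)) *m M) = dagger U *m B *m U.
  apply/matrixP => i j; rewrite mul_mx_diag mul_diag_mx !mxE.
  set w := toC (v * p j + (1 - v) * p i).
  have w0 : w != 0.
    rewrite /w toCE fmorph_eq0 lt0r_neq0 // addr_gt0 // mulr_gt0 ?p_gt0 //.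
    by rewrite subr_gt0.
  set b := (X in w^-1 * X).
  have -> : toC v * (w^-1 * b * toC (p j)) + toC (1 - v) * (toC (p i) * (w^-1 * b))
      = (toC v * toC (p j) + toC (1 - v) * toC (p i)) * w^-1 * b by ring.
  have -> : toC v * toC (p j) + toC (1 - v) * toC (p i) = w.
    by rewrite -!toCM -toCD.
  by rewrite mulfV // mul1r.
rewrite !mulmxA U_unitary mul1mx -mulmxA.
by rewrite U_unitary mulmx1.
Qed.

End Spectral.

(** * The Holevo function as a maximum *)

Section Objective.
Variables (R : realType) (D : nat).
Local Notation C := (complex R).
Variable rho : 'M[C]_D.
Hypothesis rho_sa : dagger rho = rho.

Definition holevo (X : 'I_2 -> 'M[C]_D) : R :=
  \tr (Remx (Zmat rho X)) + trnorm2 (Immx (Zmat rho X)).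

Definition lcost (L : 'M[C]_D) : R := complex.Re (\tr (L *m rho *m dagger L)).
Definition rcost (L : 'M[C]_D) : R := complex.Re (\tr (dagger L *m rho *m L)).

(** With off-diagonal entries w and -w, the squared Frobenius norm is 2w^2 and the determinant is
    w^2, so the square root is that of (2w)^2. *)
Lemma trnorm2_antisym (A : 'M[R]_2) : A 0 0 = 0 -> A 1 1 = 0 -> A 1 0 = - A 0 1 ->
  trnorm2 A = 2 * `|A 0 1|.
Proof.
move=> a00 a11 a10; rewrite /trnorm2 (expand_det_row _ 0).
rewrite !big_ord_recl !big_ord0 /cofactor !det_mx11 !mxE /=.
have -> : lift ord0 ord0 = 1 :> 'I_2 by apply: val_inj.
have -> : lift 1 0 = 0 :> 'I_2 by apply: val_inj.
rewrite -[ord0]/(0 : 'I_2) a00 a11 a10 /bump /=.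
set w := A 0 1.
have -> : 0 * ((-1) ^+ (0 + 0) * 0) + (w * ((-1) ^+ (0 + 1) * - w) + 0) = w ^+ 2.
  by ring.
rewrite ger0_norm ?sqr_ge0 //.
have -> : 0 ^+ 2 + (w ^+ 2 + 0) + ((- w) ^+ 2 + (0 ^+ 2 + 0) + 0) + 2 * w ^+ 2
   = (2 * w) ^+ 2 by ring.
by rewrite sqrtr_sqr normrM ger0_norm.
Qed.

Lemma max_sub_add_norm (s w : R) :
  Num.max (s - 2 * w) (s + 2 * w) = s + 2 * `|w|.
Proof.
have [w0|w0] := lerP 0 w; first by rewrite max_r ?ger0_norm //; lra.
by rewrite max_l ?ltr0_norm //; lra.
Qed.

Lemma mxtrace_mul_lin (M A A' B B' : 'M[C]_D) (c d : C) :
  \tr (M *m (A + c *: B) *m (A' + d *: B')) = \tr (M *m A *m A')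
  + d * \tr (M *m A *m B') + c * \tr (M *m B *m A') + c * d * \tr (M *m B *m B').
Proof.
rewrite !mulmxDr !mulmxDl -!scalemxAr -!scalemxAl !mxtraceD !mxtraceZ.
by ring.
Qed.

(* For [L = X_0 + i X_1], [L rho L^+] and [L^+ rho L] have traces
   [Tr Re Z - 2 Im Z_01] and [Tr Re Z + 2 Im Z_01], and [||Im Z||_1 = 2 |Im Z_01|]. *)
Lemma holevo_max (X : 'I_2 -> 'M[C]_D) : (forall j, hermmx (X j)) ->
  let L := X 0 + iC R *: X 1 in holevo X = Num.max (lcost L) (rcost L).
Proof.
move=> hX L.
(* Z is Hermitian, so Im Z is antisymmetric with zero diagonal and [trnorm2_antisym] applies. *)
have trc j k : \tr (rho *m X j *m X k) = conjc (\tr (rho *m X k *m X j)).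
  rewrite -mxtrace_dagger !dagger_mul rho_sa !hX.
  by rewrite -mulmxA mxtrace_mulC mulmxA.
have im j : complex.Im (\tr (rho *m X j *m X j)) = 0.
  have := congr1 (@complex.Im R) (trc j j).
  by case: (\tr _) => a b /= h; lra.
set a := complex.Re (\tr (rho *m X 0 *m X 0)).
set b := complex.Re (\tr (rho *m X 1 *m X 1)).
set w := complex.Im (\tr (rho *m X 0 *m X 1)).
have dL : dagger L = X 0 + (- iC R) *: X 1.
  rewrite /L daggerD daggerZ !hX; congr (_ + _ *: _).
  by apply/eqP; rewrite eq_complex /= oppr0 !eqxx.
have ii : - iC R * iC R = 1.
  by apply/eqP; rewrite eq_complex /=; apply/andP; split; apply/eqP; ring.
have tl : \tr (L *m rho *m dagger L) = \tr (rho *m X 0 *m X 0)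
   + \tr (rho *m X 1 *m X 1)
   + iC R * (\tr (rho *m X 0 *m X 1) - \tr (rho *m X 1 *m X 0)).
  by rewrite -mulmxA mxtrace_mulC dL /L mxtrace_mul_lin ii; do 4 move: (\tr _) => ?; ring.
have tr : \tr (dagger L *m rho *m L) = \tr (rho *m X 0 *m X 0)
   + \tr (rho *m X 1 *m X 1)
   - iC R * (\tr (rho *m X 0 *m X 1) - \tr (rho *m X 1 *m X 0)).
  by rewrite -mulmxA mxtrace_mulC dL /L mxtrace_mul_lin [iC R * - _]mulrC ii;
    do 4 move: (\tr _) => ?; ring.
have lE : lcost L = a + b - 2 * w.
  rewrite /lcost tl [\tr (rho *m X 1 *m X 0)]trc !ReD /a /b /w.
  move: (\tr _) (\tr _) (\tr _) => [? ?] [? ?] [? ?]; rewrite /iC /=; ring.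
have rE : rcost L = a + b + 2 * w.
  rewrite /rcost tr [\tr (rho *m X 1 *m X 0)]trc !ReD /a /b /w.
  move: (\tr _) (\tr _) (\tr _) => [? ?] [? ?] [? ?]; rewrite /iC /=; ring.
rewrite /holevo trnorm2_antisym ?mxE ?im //; last by rewrite trc; case: (\tr _).
rewrite /mxtrace !big_ord_recl big_ord0 !mxE -/w.
have -> : lift ord0 ord0 = 1 :> 'I_2 by apply: val_inj.
rewrite -[ord0]/(0 : 'I_2) lE rE addr0.
exact/esym/max_sub_add_norm.
Qed.

End Objective.

(** * The matrices Q as Gram matrices of the gamma operators *)

Section Gram.
Variables (R : realType) (D : nat).
Local Notation C := (complex R).
Variables (rho rho1 rho2 U : 'M[C]_D) (p : 'I_D -> R) (v : R).
Hypothesis U_unitary : unitmx_C U.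
Hypothesis p_gt0 : forall j, 0 < p j.
Hypothesis rhoE : rho = U *m diag_mx (\row_j toC (p j)) *m dagger U.
Hypothesis tr_rho : \tr rho = 1.
Hypothesis rho1_herm : hermmx rho1.
Hypothesis rho2_herm : hermmx rho2.
Hypothesis tr_rho1 : \tr rho1 = 0.
Hypothesis tr_rho2 : \tr rho2 = 0.
Hypothesis v01 : 0 < v < 1.

(** Index 0 carries [rho] itself, so that the centring condition and the two derivative conditions
    form one family of linear constraints. *)
Definition drho (i : 'I_3) : 'M[C]_D :=
  if i == 0 then rho else if i == 1 then rho1 else rho2.

Local Notation g := (gam U p rho1 rho2 v).

Lemma drho_herm i : dagger (drho i) = drho i.
Proof.
by rewrite /drho; case: ifP => _; [exact: rho_herm rhoE|case: ifP].
Qed.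

Lemma mxtrace_drho i : i != 0 -> \tr (drho i) = 0.
Proof. by rewrite /drho => /negPf->; case: ifP. Qed.

(* The Lagrange stationarity condition: [-2 gamma_i] represents the functional
   [Tr (drho_i _)] for the weighted inner product [wip] defined below. *)
Lemma gam_lyapunov i :
  toC v *: (g i *m rho) + toC (1 - v) *: (rho *m g i) = - (2%:R^-1 *: drho i).
Proof.
rewrite /gam /drho; case: ifP => _.
  rewrite mulNmx mulmxN -scalemxAl -scalemxAr mul1mx mulmx1 -scalerDl.
  by rewrite -toCD addrC subrK scale1r.
by case: ifP => _; exact: (gam_op_lyapunov U_unitary p_gt0 rhoE).
Qed.

(** Taking the trace of the Lyapunov equation merges the two terms, whose weights sum to 1, and the
    right side is traceless. *)
Lemma mxtrace_rho_gam i : i != 0 -> \tr (rho *m g i) = 0.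
Proof.
move=> i0; have := congr1 (@mxtrace C D) (gam_lyapunov i).
rewrite mxtraceD !mxtraceZ (mxtrace_mulC _ rho) -mulrDl -toCD addrC subrK.
by rewrite linearN /= mxtraceZ mxtrace_drho // mulr0 oppr0 => <-; rewrite mul1r.
Qed.

Lemma gam0 : g 0 = - (2%:R^-1 *: 1%:M).
Proof. by []. Qed.

Lemma dagger_gam0 : dagger (g 0) = g 0.
Proof.
rewrite gam0; apply/matrixP => k l; rewrite daggerE !mxE rmorphN rmorphM.
by rewrite rmorphV ?unitfE ?pnatr_eq0 // !rmorph_nat eq_sym.
Qed.

(** The constants in the first row and column are the true traces: [g 0] is -1/2 and [rho] has trace
    1, which gives 1/4, and the zeros come from [mxtrace_rho_gam]. The same reasoning serves
    [Gmat2E] and, with tracelessness of the derivatives, [Gmat3E]. *)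
Lemma Gmat1E i j :
  Gmat1 rho rho1 rho2 U p v i j = \tr (g i *m rho *m dagger (g j)).
Proof.
rewrite mxE; case: (eqVneq i 0) => [->|i0] /=; last first.
  case: (eqVneq j 0) => [->|//] /=.
  rewrite dagger_gam0 gam0 mulmxN -scalemxAr mulmx1 linearN /= mxtraceZ mxtrace_mulC.
  by rewrite mxtrace_rho_gam // mulr0 oppr0.
rewrite gam0 mulNmx -scalemxAl mul1mx mulNmx -scalemxAl linearN /= mxtraceZ.
case: (eqVneq j 0) => [->|j0].
  rewrite dagger_gam0 gam0 mulmxN -scalemxAr mulmx1 linearN /= mxtraceZ tr_rho mulr1.
  by rewrite mulrN opprK -invfM -natrM.
rewrite -{1}(rho_herm rhoE) -dagger_mul mxtrace_dagger mxtrace_mulC.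
by rewrite mxtrace_rho_gam // rmorph0 mulr0 oppr0.
Qed.

Lemma Gmat2E i j :
  Gmat2 rho rho1 rho2 U p v i j = \tr (dagger (g i) *m rho *m g j).
Proof.
rewrite mxE; case: (eqVneq i 0) => [->|i0] /=; last first.
  case: (eqVneq j 0) => [->|//] /=.
  rewrite gam0 mulmxN -scalemxAr mulmx1 linearN /= mxtraceZ.
  rewrite -(rho_herm rhoE) -dagger_mul mxtrace_dagger.
  by rewrite mxtrace_rho_gam // rmorph0 mulr0 oppr0.
rewrite dagger_gam0 gam0 mulNmx -scalemxAl mul1mx mulNmx -scalemxAl linearN /= mxtraceZ.
case: (eqVneq j 0) => [->|j0].
  rewrite gam0 mulmxN -scalemxAr mulmx1 linearN /= mxtraceZ tr_rho mulr1.
  by rewrite mulrN opprK -invfM -natrM.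
by rewrite mxtrace_rho_gam // mulr0 oppr0.
Qed.

Lemma Gmat3E i j : Gmat3 rho rho1 rho2 U p v i j = \tr (drho i *m g j).
Proof.
rewrite mxE; case: (eqVneq i 0) => [->|i0] /=.
  case: (eqVneq j 0) => [->|j0]; last by rewrite mxtrace_rho_gam.
  by rewrite gam0 mulmxN -scalemxAr mulmx1 linearN /= mxtraceZ tr_rho mulr1.
case: (eqVneq j 0) => [->|j0] /=; last by rewrite /drho (negPf i0).
rewrite gam0 mulmxN -scalemxAr mulmx1 linearN /= mxtraceZ mxtrace_drho //.
by rewrite mulr0 oppr0.
Qed.

(** * Real block matrices as real parts of sesquilinear forms on three complex coordinates *)

Definition zcomp (x : 'cV[R]_(3 + 3)) (i : 'I_3) : C :=
  Complex (x (lshift 3 i) 0) (x (rshift 3 i) 0).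

Lemma bilinear_block (A : 'M[R]_(3 + 3)) (x y : 'cV[R]_(3 + 3)) :
  (y^T *m A *m x) 0 0 = \sum_i \sum_j
   (y (lshift 3 i) 0 * A (lshift 3 i) (lshift 3 j) * x (lshift 3 j) 0
    + y (lshift 3 i) 0 * A (lshift 3 i) (rshift 3 j) * x (rshift 3 j) 0
    + y (rshift 3 i) 0 * A (rshift 3 i) (lshift 3 j) * x (lshift 3 j) 0
    + y (rshift 3 i) 0 * A (rshift 3 i) (rshift 3 j) * x (rshift 3 j) 0).
Proof.
have -> : (y^T *m A *m x) 0 0 = \sum_i \sum_j y i 0 * A i j * x j 0.
  rewrite -mulmxA mxE; apply: eq_bigr => i _; rewrite !mxE mulr_sumr.
  by apply: eq_bigr => j _; rewrite mulrA.
rewrite big_split_ord /= -big_split /=; apply: eq_bigr => i _.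
by rewrite !big_split_ord /= -!big_split /= ; apply: eq_bigr => j _; rewrite !addrA.
Qed.

(** The real part of the block matrix has Re G on the diagonal and Im G, -Im G off it. The opposite
    signs, in [Re_block_plus], move the conjugation to the other argument. *)
Lemma Re_block_minus (G : 'M[C]_3) (x y : 'cV[R]_(3 + 3)) :
  (y^T *m Remx (block_mx G (- iC R *: G) (iC R *: G) G) *m x) 0 0 =
  complex.Re (\sum_i \sum_j zcomp y i * G i j * conjc (zcomp x j)).
Proof.
rewrite bilinear_block Re_sum; apply: eq_bigr => i _.
rewrite Re_sum; apply: eq_bigr => j _.
rewrite /Remx map_block_mx block_mxEul block_mxEur block_mxEdl block_mxEdr.
by rewrite !mxE /iC /zcomp; case: (G i j) => a b /=; ring.
Qed.

Lemma Re_block_plus (G : 'M[C]_3) (x y : 'cV[R]_(3 + 3)) :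
  (y^T *m Remx (block_mx G (iC R *: G) (- iC R *: G) G) *m x) 0 0 =
  complex.Re (\sum_i \sum_j conjc (zcomp y i) * G i j * zcomp x j).
Proof.
rewrite bilinear_block Re_sum; apply: eq_bigr => i _.
rewrite Re_sum; apply: eq_bigr => j _.
rewrite /Remx map_block_mx block_mxEul block_mxEur block_mxEdl block_mxEdr.
by rewrite !mxE /iC /zcomp; case: (G i j) => a b /=; ring.
Qed.


Definition gcomb (x : 'cV[R]_(3 + 3)) : 'M[C]_D := \sum_i zcomp x i *: g i.
Definition dcomb (x : 'cV[R]_(3 + 3)) : 'M[C]_D := \sum_i zcomp x i *: drho i.

Lemma mxtrace_sesq_r (I : finType) (a b : I -> C) (A B : I -> 'M[C]_D) (M : 'M[C]_D) :
  \tr ((\sum_i a i *: A i) *m M *m dagger (\sum_i b i *: B i)) =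
  \sum_i \sum_j a i * \tr (A i *m M *m dagger (B j)) * conjc (b j).
Proof.
rewrite !mulmx_suml raddf_sum; apply: eq_bigr => i _ /=.
rewrite dagger_sum mulmx_sumr raddf_sum; apply: eq_bigr => j _ /=.
by rewrite daggerZ -!scalemxAl -scalemxAr !mxtraceZ mulrCA mulrA mulrC mulrA [_ * a i]mulrC mulrA.
Qed.

Lemma mxtrace_sesq_l (I : finType) (a b : I -> C) (A B : I -> 'M[C]_D) (M : 'M[C]_D) :
  \tr (dagger (\sum_i a i *: A i) *m M *m (\sum_i b i *: B i)) =
  \sum_i \sum_j conjc (a i) * \tr (dagger (A i) *m M *m B j) * b j.
Proof.
rewrite dagger_sum !mulmx_suml raddf_sum; apply: eq_bigr => i _ /=.
rewrite mulmx_sumr raddf_sum; apply: eq_bigr => j _ /=.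
by rewrite daggerZ -!scalemxAl -scalemxAr !mxtraceZ mulrCA mulrC.
Qed.

Lemma Re_form_Qmat1 x y :
  (y^T *m Remx (Qmat1 rho rho1 rho2 U p v) *m x) 0 0 =
  complex.Re (\tr (gcomb y *m rho *m dagger (gcomb x))).
Proof.
rewrite Re_block_minus mxtrace_sesq_r; congr complex.Re.
by apply: eq_bigr => i _; apply: eq_bigr => j _; rewrite Gmat1E.
Qed.

Lemma Re_form_Qmat2 x y :
  (y^T *m Remx (Qmat2 rho rho1 rho2 U p v) *m x) 0 0 =
  complex.Re (\tr (dagger (gcomb y) *m rho *m gcomb x)).
Proof.
rewrite Re_block_plus mxtrace_sesq_l; congr complex.Re.
by apply: eq_bigr => i _; apply: eq_bigr => j _; rewrite Gmat2E.
Qed.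

(** The symmetrised blocks are already real: half of G + conj G is Re G, and half of i(G - conj G)
    is -Im G, the real part of iG. Hence [Re_block_plus] also covers [Qmat3]. *)
Lemma Remx_Qmat3 (G : 'M[C]_3) :
  Remx (2%:R^-1 *: block_mx (G + Defs.conjmx G) (iC R *: (G - Defs.conjmx G))
                      (- iC R *: (G - Defs.conjmx G)) (G + Defs.conjmx G)) =
  Remx (block_mx G (iC R *: G) (- iC R *: G) G).
Proof.
rewrite /Remx scale_block_mx !map_block_mx half_toC.
by congr block_mx; apply/matrixP => i j; rewrite !mxE Re_toCM /iC;
  case: (G i j) => a b /=; field.
Qed.

Lemma Re_form_Qmat3 x y :
  (y^T *m Remx (Qmat3 rho rho1 rho2 U p v) *m x) 0 0 =
  complex.Re (\tr (dagger (dcomb y) *m gcomb x)).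
Proof.
rewrite Remx_Qmat3 Re_block_plus -[dagger _]mulmx1 mxtrace_sesq_l.
congr complex.Re.
by apply: eq_bigr => i _; apply: eq_bigr => j _; rewrite mulmx1 drho_herm Gmat3E.
Qed.

(** * The weighted inner product and its constrained minimiser *)

Definition wip (A B : 'M[C]_D) : C :=
  toC v * \tr (A *m rho *m dagger B) + toC (1 - v) * \tr (dagger B *m rho *m A).

Lemma wip_conj A B : wip A B = conjc (wip B A).
Proof.
have rh := rho_herm rhoE.
rewrite /wip conjcD !conjcM !conjc_toC -!mxtrace_dagger !dagger_mul rh !daggerK.
by rewrite !mulmxA.
Qed.

Lemma wipDl A B E : wip (A + B) E = wip A E + wip B E.
Proof. by rewrite /wip !(mulmxDl, mulmxDr) !mxtraceD; ring. Qed.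

Lemma wipDr A B E : wip E (A + B) = wip E A + wip E B.
Proof. by rewrite wip_conj wipDl conjcD -!wip_conj. Qed.

Lemma Re_wip_diag A :
  complex.Re (wip A A) = v * lcost rho A + (1 - v) * rcost rho A.
Proof. by rewrite ReD !Re_toCM. Qed.

Lemma lcost_ge0 (A : 'M[C]_D) : 0 <= lcost rho A.
Proof. by have := mxtrace_rho_ge0 p_gt0 rhoE A; rewrite lecE => /andP[]. Qed.

Lemma wip_ge0 A : 0 <= complex.Re (wip A A).
Proof.
have /andP[v0 v1] := v01.
rewrite Re_wip_diag addr_ge0 // mulr_ge0 ?(ltW v0) ?subr_ge0 ?(ltW v1) //.
  exact: lcost_ge0.
by rewrite /rcost -{2}(daggerK A) lcost_ge0.
Qed.

Lemma gcomb_lyapunov x :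
  toC v *: (gcomb x *m rho) + toC (1 - v) *: (rho *m gcomb x)
  = - (2%:R^-1 *: dcomb x).
Proof.
rewrite /gcomb /dcomb mulmx_suml mulmx_sumr !scaler_sumr -big_split -sumrN /=.
apply: eq_bigr => i _; rewrite scalerA [2%:R^-1 * _]mulrC -scalerA -scalerN -gam_lyapunov.
by rewrite -scalemxAl -scalemxAr scalerDr !scalerA ![zcomp x i * _]mulrC.
Qed.

(** Cyclicity gathers both terms into one trace against [dagger B], where the Lyapunov equation
    applies. A product with [gcomb x] thus sees [B] only through the constraint functionals. *)
Lemma wip_gcomb x B : wip (gcomb x) B = - (2%:R^-1 * \tr (dcomb x *m dagger B)).
Proof.
rewrite /wip -(mulmxA (dagger B)) (mxtrace_mulC (dagger B)) -!mxtraceZ.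
rewrite -mxtraceD !(scalemxAl _ _ (dagger B)) -mulmxDl gcomb_lyapunov mulNmx.
by rewrite linearN /= -scalemxAl mxtraceZ.
Qed.

(** The weighted [Qmat1] and [Qmat2] terms add up to the real part of [wip], which is minus half the
    [Qmat3] term by [wip_gcomb]. Half of the [Qmat3] term remains, so [Qmat] is minus the real Gram
    matrix of [wip]. *)
Lemma form_Qmat x y :
  (y^T *m Qmat rho rho1 rho2 U p v *m x) 0 0 =
  2%:R^-1 * complex.Re (\tr (dagger (dcomb y) *m gcomb x)).
Proof.
rewrite /Qmat !(mulmxDl, mulmxDr) -!scalemxAr -!scalemxAl.
have e (A B E : 'M[R]_1) a b :
  (a *: A + b *: B + E) 0 0 = a * A 0 0 + b * B 0 0 + E 0 0 by rewrite !mxE.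
rewrite e Re_form_Qmat1 Re_form_Qmat2 Re_form_Qmat3.
(* Conjugation swaps the arguments of the second form, to match the second term of [wip]. *)
have -> : complex.Re (\tr (dagger (gcomb y) *m rho *m gcomb x))
        = complex.Re (\tr (dagger (gcomb x) *m rho *m gcomb y)).
  by rewrite -Re_conjc -mxtrace_dagger !dagger_mul (rho_herm rhoE) daggerK mulmxA.
rewrite -!Re_toCM -ReD -[toC v * _ + _]/(wip (gcomb y) (gcomb x)) wip_gcomb.
have -> : \tr (dcomb y *m dagger (gcomb x)) =
    conjc (\tr (dagger (dcomb y) *m gcomb x)).
  by rewrite -mxtrace_dagger dagger_mul daggerK mxtrace_mulC.
by rewrite half_toC ReN !Re_toCM Re_conjc; field.
Qed.

Lemma zcomp_deltal i j : zcomp (delta_mx (lshift 3 i) 0) j = (j == i)%:R.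
Proof. by rewrite /zcomp !mxE eq_lshift eq_rlshift /= andbT; case: (j == i). Qed.

Lemma zcomp_deltar i j :
  zcomp (delta_mx (rshift 3 i) 0) j = iC R * (j == i)%:R.
Proof.
rewrite /zcomp !mxE eq_rshift eq_lrshift /= andbT.
by case: (j == i); rewrite ?mulr1 ?mulr0.
Qed.

(** By [form_Qmat] the linear system is the constraint system in real coordinates, the two factors
    1/2 cancelling. Testing it on basis vectors of the two blocks reads off real and imaginary
    parts. *)
Lemma mxtrace_drho_gcomb x i : Qmat rho rho1 rho2 U p v *m x = 2%:R^-1 *: bvec R ->
  \tr (drho i *m gcomb x) = zcomp (bvec R) i.
Proof.
move=> Qx.
have Qy y : complex.Re (\tr (dagger (dcomb y) *m gcomb x)) = (y^T *m bvec R) 0 0.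
  have := form_Qmat x y; rewrite -mulmxA Qx -scalemxAr mxE => /(congr1 ( *%R 2%:R)).
  by rewrite !mulrA mulfV ?pnatr_eq0 // !mul1r => ->.
have yb k : ((delta_mx k 0 : 'cV[R]_(3 + 3))^T *m bvec R) 0 0 = bvec R k 0.
  rewrite mxE (bigD1 k) //= big1 => [|j jk].
    by rewrite !mxE !eqxx mul1r addr0.
  by rewrite !mxE (negPf jk) mul0r.
apply/eqP; rewrite eq_complex; apply/andP; split; apply/eqP => /=.
  rewrite -yb -Qy; congr (complex.Re (\tr (_ *m _))).
  rewrite /dcomb (bigD1 i) //= big1 => [|j ji].
    by rewrite zcomp_deltal eqxx scale1r addr0 drho_herm.
  by rewrite zcomp_deltal (negPf ji) scale0r.
rewrite -yb -Qy.
(* The adjoint contributes a factor -i, which turns the imaginary part of the trace into a real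
   part. *)
have -> : dcomb (delta_mx (rshift 3 i) 0) = iC R *: drho i.
  rewrite /dcomb (bigD1 i) //= big1 => [|j ji].
    by rewrite zcomp_deltar eqxx mulr1 addr0.
  by rewrite zcomp_deltar (negPf ji) mulr0 scale0r.
rewrite daggerZ drho_herm -scalemxAl mxtraceZ; case: (\tr _) => a b /=.
by rewrite /iC /=; ring.
Qed.

(** Pythagoras: [L] and [gcomb x] satisfy the same constraints, so their difference is annihilated
    by every [drho i] and is orthogonal to [gcomb x] by [wip_gcomb]. *)
Lemma wip_gcomb_min x (L : 'M[C]_D) :
  Qmat rho rho1 rho2 U p v *m x = 2%:R^-1 *: bvec R ->
  (forall i, \tr (drho i *m L) = zcomp (bvec R) i) ->
  complex.Re (wip (gcomb x) (gcomb x)) <= complex.Re (wip L L).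
Proof.
move=> Qx hL; set A := gcomb x.
have [B LAB] : exists B, L = A + B by exists (L - A); rewrite addrC subrK.
have AB : wip A B = 0.
  have -> : B = L - A by rewrite LAB addrC addKr.
  rewrite wip_gcomb /dcomb mulmx_suml raddf_sum big1 ?mulr0 ?oppr0 // => i _ /=.
  rewrite -scalemxAl mxtraceZ -(drho_herm i) -dagger_mul mxtrace_dagger mxtrace_mulC.
  by rewrite mulmxBr mxtraceD linearN /= hL mxtrace_drho_gcomb // subrr rmorph0 mulr0.
have BA : wip B A = 0 by rewrite wip_conj AB; exact: conjc0.
rewrite LAB wipDl !wipDr AB BA addr0 add0r (ReD (wip A A)) lerDl.
exact: wip_ge0.
Qed.


(** * The two bounds as costs of the minimiser *)

Hypothesis Q_unit : Qmat rho rho1 rho2 U p v \in unitmx.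

Definition xopt : 'cV[R]_(3 + 3) :=
  2%:R^-1 *: (invmx (Qmat rho rho1 rho2 U p v) *m bvec R).

Lemma Qmat_xopt : Qmat rho rho1 rho2 U p v *m xopt = 2%:R^-1 *: bvec R.
Proof. by rewrite /xopt -scalemxAr mulmxA mulmxV // mul1mx. Qed.

Lemma lowerL_wip :
  lowerL rho rho1 rho2 U p v = complex.Re (wip (gcomb xopt) (gcomb xopt)).
Proof.
have := form_Qmat xopt xopt; rewrite -mulmxA Qmat_xopt -scalemxAr mxE.
(* The product is a 1 by 1 matrix, hence equal to its transpose, the product of [bvec] transposed
   with [xopt]. *)
have -> : (xopt^T *m bvec R) 0 0 = 2%:R^-1 * bQb rho rho1 rho2 U p v.
  rewrite /bQb -mulmxA -[(xopt^T *m bvec R)]trmxK trmx_mul trmxK mxE.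
  by rewrite /xopt -scalemxAr mxE.
rewrite wip_gcomb.
have -> : \tr (dcomb xopt *m dagger (gcomb xopt)) =
    conjc (\tr (dagger (dcomb xopt) *m gcomb xopt)).
  by rewrite -mxtrace_dagger dagger_mul daggerK mxtrace_mulC.
by rewrite half_toC ReN Re_toCM Re_conjc => <-; rewrite /lowerL; field.
Qed.

Lemma Re_quad_toC (M : 'M[C]_(3 + 3)) (y : 'cV[R]_(3 + 3)) :
  complex.Re (((map_mx (@toC R) y)^T *m M *m map_mx (@toC R) y) 0 0) =
  (y^T *m Remx M *m y) 0 0.
Proof.
rewrite !mxE Re_sum; apply: eq_bigr => i _; rewrite !mxE mulrC Re_toCM mulrC.
congr (_ * _); rewrite Re_sum; apply: eq_bigr => j _.
by rewrite !mxE Re_toCM.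
Qed.

(** The factor 1/4 is the square of the 1/2 in [xopt], and the two quadratic forms are the left and
    right costs of [gcomb xopt]. *)
Lemma upperU_cost :
  upperU rho rho1 rho2 U p v =
  Num.max (lcost rho (gcomb xopt)) (rcost rho (gcomb xopt)).
Proof.
rewrite /upperU /bQQQb !Re_quad_toC.
have h (M : 'M[R]_(3 + 3)) (y : 'cV[R]_(3 + 3)) :
  ((2%:R^-1 *: y)^T *m M *m (2%:R^-1 *: y)) 0 0 = 4%:R^-1 * (y^T *m M *m y) 0 0.
  have -> : (2%:R^-1 *: y)^T = 2%:R^-1 *: y^T by rewrite linearZ.
  rewrite -!scalemxAl -scalemxAr scalerA mxE; congr (_ * _).
  by rewrite -invfM -natrM.
by rewrite maxr_pMr ?invr_ge0 ?ler0n // -!h Re_form_Qmat1 Re_form_Qmat2.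
Qed.

(** The constraints on [L] do not involve [v], so one fixed [L] bounds the lower bound at every
    weight by an affine function of [v]. The stationarity argument rests on this. *)
Lemma lowerL_le (L : 'M[C]_D) :
  (forall i, \tr (drho i *m L) = zcomp (bvec R) i) ->
  lowerL rho rho1 rho2 U p v <= v * lcost rho L + (1 - v) * rcost rho L.
Proof. by move=> hL; rewrite lowerL_wip -Re_wip_diag; exact: wip_gcomb_min Qmat_xopt hL. Qed.

Lemma lowerL_cost : lowerL rho rho1 rho2 U p v =
  v * lcost rho (gcomb xopt) + (1 - v) * rcost rho (gcomb xopt).
Proof. by rewrite lowerL_wip Re_wip_diag. Qed.

Lemma mxtrace_drho_gcomb_xopt i :
  \tr (drho i *m gcomb xopt) = zcomp (bvec R) i.
Proof. exact/mxtrace_drho_gcomb/Qmat_xopt. Qed.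

End Gram.

(** * Feasible points *)

Section Feasible.
Variables (R : realType) (D : nat).
Local Notation C := (complex R).
Variables (rho rho1 rho2 : 'M[C]_D).

Lemma ord3P (P : 'I_3 -> Prop) : P 0 -> (forall j : 'I_2, P (lift 0 j)) -> forall i, P i.
Proof. by move=> P0 P1 i; case: (unliftP 0 i) => [j|] ->. Qed.

Lemma drho_lift (j : 'I_2) :
  drho rho rho1 rho2 (lift 0 j) = if j == 0 then rho1 else rho2.
Proof. by rewrite /drho; case: j => [[|[|//]]]. Qed.

Lemma zcomp_bvec0 : zcomp (bvec R) 0 = 0.
Proof. by rewrite /zcomp !mxE. Qed.

Lemma zcomp_bvec_lift (j : 'I_2) :
  zcomp (bvec R) (lift 0 j) = if j == 0 then 1 else iC R.
Proof. by rewrite /zcomp !mxE; case: j => [[|[|//]]]. Qed.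

Lemma feasible_mxtrace_drho X : feasible rho rho1 rho2 X ->
  forall i, \tr (drho rho rho1 rho2 i *m (X 0 + iC R *: X 1)) = zcomp (bvec R) i.
Proof.
move=> [_ [hr h12]]; apply: ord3P => [|j]; rewrite mulmxDr -scalemxAr mxtraceD mxtraceZ.
  by rewrite /drho eqxx !hr mulr0 addr0 zcomp_bvec0.
rewrite drho_lift zcomp_bvec_lift !h12.
by case: j => [[|[|//]]] i /=; rewrite ?mulr0 ?mulr1 ?addr0 ?add0r.
Qed.

(** Take the Cartesian decomposition of [L]. As each [drho i] is Hermitian, the traces against the
    Hermitian parts are the real and imaginary parts of the prescribed values 0, 1, i. *)
Lemma feasible_of_mxtrace_drho (L : 'M[C]_D) :
  dagger rho = rho -> hermmx rho1 -> hermmx rho2 ->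
  (forall i, \tr (drho rho rho1 rho2 i *m L) = zcomp (bvec R) i) ->
  exists2 X, feasible rho rho1 rho2 X & L = X 0 + iC R *: X 1.
Proof.
move=> h0 h1 h2 hL.
have hd i : dagger (drho rho rho1 rho2 i) = drho rho rho1 rho2 i.
  by rewrite /drho; case: ifP => _ //; case: ifP.
have hLd i : \tr (drho rho rho1 rho2 i *m dagger L) = conjc (zcomp (bvec R) i).
  by rewrite -{1}hd -dagger_mul mxtrace_dagger mxtrace_mulC hL.
have c2 : conjc (2%:R^-1) = 2%:R^-1 :> C by rewrite half_toC conjc_toC.
have cI : conjc (iC R) = - iC R by apply/eqP; rewrite eq_complex /= oppr0 !eqxx.
have ii : iC R * iC R = -1.
  by apply/eqP; rewrite eq_complex /=; apply/andP; split; apply/eqP; ring.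
have n2 : (2%:R : C) != 0 by rewrite pnatr_eq0.
pose X (j : 'I_2) := if j == 0 then 2%:R^-1 *: (L + dagger L)
                     else (2%:R^-1 * iC R) *: (dagger L - L).
have trX i j : \tr (drho rho rho1 rho2 i *m X j) =
    if j == 0 then toC (complex.Re (zcomp (bvec R) i))
    else toC (complex.Im (zcomp (bvec R) i)).
  move: (hL i) (hLd i); case: (zcomp (bvec R) i) => a b ei eid.
  rewrite /X; case: ifP => _; rewrite -scalemxAr mxtraceZ.
    rewrite mulmxDr mxtraceD ei eid.
    apply: (mulfI n2); rewrite mulrA mulfV // mul1r mulr_natl mulr2n.
    by apply/eqP; rewrite eq_complex /=; apply/andP; split; apply/eqP; ring.
  rewrite mulmxBr linearB /= ei eid.
  apply: (mulfI n2); rewrite !mulrA mulfV // mul1r mulr_natl mulr2n.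
  by apply/eqP; rewrite eq_complex /=; apply/andP; split; apply/eqP; ring.
exists X; last first.
  have -> : X 0 = 2%:R^-1 *: (L + dagger L) by [].
  have -> : X 1 = (2%:R^-1 * iC R) *: (dagger L - L) by [].
  rewrite scalerA [iC R * _]mulrCA ii mulrN1 scaleNr -scalerN -scalerDr.
  rewrite opprB addrACA subrr addr0 scalerDr -scalerDl.
  have -> : 2%:R^-1 + 2%:R^-1 = 1 :> C by field.
  by rewrite scale1r.
split; [|split].
- move=> j; rewrite /hermmx /X; case: ifP => _; rewrite daggerZ.
    by rewrite c2 daggerD daggerK addrC.
  by rewrite conjcM c2 cI mulrN scaleNr -scalerN daggerD daggerK daggerN opprB.
- by move=> j; rewrite -[rho]/(drho rho rho1 rho2 0) trX zcomp_bvec0; case: ifP.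
- move=> j k; rewrite -drho_lift trX zcomp_bvec_lift.
  by case: j => [[|[|//]]] i; case: k => [[|[|//]]] i' /=.
Qed.

End Feasible.

(** * Affine minorants at a stationary point *)

Section Stationary.
Import numFieldNormedType.Exports.

(** An affine minorant touching [f] at the interior point [u] has slope f'(u). Here Caratheodory's
    form of the derivative is used: the slope function [g] is continuous at [u] with value 0. *)
Lemma is_derive0_sub_affine (R : realType) (f : R -> R) (u c : R) :
  0 < u < 1 -> is_derive u (1 : R) f 0 ->
  (forall v, 0 < v < 1 -> (v - u) * c <= f v - f u) -> c = 0.
Proof.
move=> /andP[u0 u1] /is_derive1_caratheodory[g [fg gc gu]] h.
apply/eqP/negPn/negP => c0.
have nc : 0 < `|c| by rewrite normr_gt0.
have /cvgrPdist_lt/(_ _ nc)/nbhs_ballP : (g x @[x --> u] --> (0 : R))%classic.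
  by rewrite -gu; exact: gc.
move=> [e /= e0 he].
(* The step keeps both u + d and u - d inside the unit interval and strictly inside the ball where
   |g| < |c|. *)
pose d := Num.min (e / 2) (Num.min (u / 2) ((1 - u) / 2)).
have d0 : 0 < d by rewrite !lt_min !divr_gt0 // subr_gt0.
have du : d <= u / 2 by rewrite /d !ge_min lexx orbT.
have du1 : d <= (1 - u) / 2 by rewrite /d !ge_min lexx !orbT.
have de : d <= e / 2 by rewrite /d ge_min lexx.
have key s : `|s| = 1 -> s * c <= g (u + s * d) * s.
  move=> s1.
  have sd : `|s * d| = d by rewrite normrM s1 mul1r gtr0_norm.
  have : 0 < u + s * d < 1.
    have := ler_norm (s * d); have := ler_norm (- (s * d)); rewrite normrN sd.
    by move=> ? ?; apply/andP; split; lra.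
  move=> /h; rewrite fg addrAC subrr add0r mulrAC [g _ * _]mulrA ler_pM2r //.
have gs s : `|s| = 1 -> `|g (u + s * d)| < `|c|.
  move=> s1; have := he (u + s * d); rewrite sub0r normrN; apply.
  rewrite /ball /= opprD addrA subrr add0r normrN normrM s1 mul1r gtr0_norm //.
  by lra.
have k1 := key 1 (normr1 _); have g1 := gs 1 (normr1 _).
have k2 := key (-1) (normrN1 _); have g2 := gs (-1) (normrN1 _).
move: g1 g2; rewrite !ltr_norml => /andP[? ?] /andP[? ?].
(* The right step gives c <= g(u + d) and the left step g(u - d) <= c; the one matching the sign of
   [c] contradicts |g| < |c|. *)
have [cp|cn] := ltrP 0 c.
  by have := gtr0_norm cp; lra.
by have := ler0_norm cn; lra.
Qed.

End Stationary.

(** * Assembly of the two bounds and of the equality case *)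

Theorem theorem3 (R : realType) (D : nat)
  (rho rho1 rho2 U : 'M[complex R]_D) (p : 'I_D -> R) (u : R) :
  (* full-rank density matrix with spectral decomposition rho = U diag(p) U^dagger *)
  unitmx_C U ->
  (forall j, 0 < p j) ->
  rho = U *m diag_mx (\row_j toC (p j)) *m dagger U ->
  \tr rho = 1 ->
  (* the derivatives d_1 rho, d_2 rho : Hermitian and traceless *)
  hermmx rho1 -> hermmx rho2 ->
  \tr rho1 = 0 -> \tr rho2 = 0 ->
  0 < u < 1 ->
  negdef (Qmat rho rho1 rho2 U p u) ->
  (forall v, 0 < v < 1 -> \rank (Qmat rho rho1 rho2 U p v) = (3 + 3)%N) ->
  (lowerL rho rho1 rho2 U p u <= HCRB rho rho1 rho2 /\
   HCRB rho rho1 rho2 <= upperU rho rho1 rho2 U p u) /\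
  (is_derive u (1 : R) (fun v => bQb rho rho1 rho2 U p v) 0 ->
   lowerL rho rho1 rho2 U p u = HCRB rho rho1 rho2 /\
   HCRB rho rho1 rho2 = upperU rho rho1 rho2 U p u).
Proof.
move=> Uu p0 rE tr1 h1 h2 t1 t2 u01 _ rk.
have h0 := rho_herm rE.
have Qu v : 0 < v < 1 -> Qmat rho rho1 rho2 U p v \in unitmx.
  by move=> /rk rv; rewrite -row_free_unit /row_free rv.
set L := gcomb rho1 rho2 U p u (xopt rho rho1 rho2 U p u).
have hL i : \tr (drho rho rho1 rho2 i *m L) = zcomp (bvec R) i.
  by apply: mxtrace_drho_gcomb_xopt => //; exact: Qu.
have [X0 fX0 LX0] := feasible_of_mxtrace_drho h0 h1 h2 hL.
have lo v X : 0 < v < 1 -> feasible rho rho1 rho2 X ->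
    lowerL rho rho1 rho2 U p v <= holevo rho X.
  move=> v01 fX; set LX := X 0 + iC R *: X 1.
  (* The convex combination of the two costs separates the constrained minimum from their
     maximum. *)
  apply: (@le_trans _ _ (v * lcost rho LX + (1 - v) * rcost rho LX)).
    by apply: lowerL_le => //; [exact: Qu|exact: feasible_mxtrace_drho].
  rewrite (holevo_max h0) -/LX; last by case: fX.
  have [v0 v1] := andP v01.
  have : v * lcost rho LX <= v * Num.max (lcost rho LX) (rcost rho LX).
    by rewrite ler_pM2l // le_max lexx.
  have : (1 - v) * rcost rho LX <= (1 - v) * Num.max (lcost rho LX) (rcost rho LX).
    by rewrite ler_pM2l ?subr_gt0 // le_max lexx orbT.
  by move: (lcost _ _) (rcost _ _) (Num.max _ _) => l r m; clear; lra.
have upE : upperU rho rho1 rho2 U p u = holevo rho X0.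
  rewrite (holevo_max h0); last by case: fX0.
  by rewrite -LX0; apply: upperU_cost => //; exact: Qu.
have lH : lowerL rho rho1 rho2 U p u <= HCRB rho rho1 rho2.
  (* Both comparisons with [inf] need the set to be proper: [X0] makes it nonempty here, and [lo]
     bounds it below in the next one. *)
  apply: lb_le_inf; first by exists (holevo rho X0); exists X0.
  by move=> _ [X [fX ->]]; exact: lo.
have Hu : HCRB rho rho1 rho2 <= upperU rho rho1 rho2 U p u.
  rewrite upE; apply: ge_inf; last by exists X0.
  by exists (lowerL rho rho1 rho2 U p u) => _ [X [fX ->]]; exact: lo.
split=> // dQ.
have lu := lowerL_cost Uu p0 rE tr1 h1 h2 t1 t2 u01 (Qu _ u01); rewrite -/L in lu.
(* Since [bQb] is -4 times the lower bound, the affine majorant of the latter, of slope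
   [lcost rho L - rcost rho L], becomes an affine minorant of [bQb] with this slope, touching at
   [u]. *)
have /eqP : 4 * (rcost rho L - lcost rho L) = 0.
  apply: (is_derive0_sub_affine u01 dQ) => v v01.
  have := lowerL_le Uu p0 rE tr1 h1 h2 t1 t2 v01 (Qu _ v01) hL.
  move: lu; rewrite /lowerL; move: (bQb _ _ _ _ _ u) (bQb _ _ _ _ _ v).
  move: (lcost rho L) (rcost rho L) => l r bu bv; clear; lra.
rewrite mulf_eq0 pnatr_eq0 /= subr_eq0 => /eqP rl.
(* With equal costs the convex combination and the maximum have the same value, so the bounds
   squeeze [HCRB]. *)
have : lowerL rho rho1 rho2 U p u = upperU rho rho1 rho2 U p u.
  rewrite upE (holevo_max h0) -?LX0; last by case: fX0.
  by rewrite rl maxxx lu rl -mulrDl addrC subrK mul1r.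
by move=> lU; split; apply/eqP; rewrite eq_le ?lH ?Hu //= ?lU // -lU.
Qed.
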